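(* Let $\Pi X.\,s\,[\exists\vec{x}.\varphi]$ and $\Pi Y.\,t\,[\exists\vec{y}.\psi]$ be existentially constrained terms. Then $\Pi X.\,s\,[\exists\vec{x}.\varphi]\sim\Pi Y.\,t\,[\exists\vec{y}.\psi]$ if and only if $[\![\Pi X.\,s\,[\exists\vec{x}.\varphi]]\!]_{\mathsf v}=[\![\Pi Y.\,t\,[\exists\vec{y}.\psi]]\!]_{\mathsf v}$.
   Context: Terms are built over a sorted signature whose function symbols are split into theory symbols (whose argument and result sorts are theory sorts) and term symbols, and a set $\mathcal{V}$ of sorted variables; theory sorts and symbols are interpreted in a fixed model $\mathcal{M}$. Every element of the interpretation of each theory sort is a constant symbol, called a value; $\mathcal{V}al$ denotes the set of values. There is a theory sort of Booleans with standard interpretation and the usual connectives. A constraint is a Boolean-sorted term built from theory symbols and variables; a (possibly existentially quantified) formula is valid if it is true under all valuations of its free variables in $\mathcal{M}$. $\mathcal{V}ar(\cdot)$ is the set of variables. A substitution $\sigma$ is a sort-preserving map from variables to terms with finite domain; $\sigma$ is $X$-valued if $\sigma(X)\subseteq\mathcal{V}al$. An existential constraint $\exists\vec{x}.\varphi$ is a sequence of variables $\vec x$ together with a constraint $\varphi$ with $\{\vec x\}\subseteq\mathcal{V}ar(\varphi)$; its free variables are $\mathcal{FV}ar(\exists\vec x.\varphi)=\mathcal{V}ar(\varphi)\setminus\{\vec x\}$. For a substitution $\sigma$, $\sigma\vDash_{\mathcal M}\exists\vec x.\varphi$ means $\sigma$ is $\mathcal{FV}ar(\exists\vec x.\varphi)$-valued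 and $(\exists\vec x.\varphi)\sigma$ is valid. An existentially constrained term $\Pi X.\,s\,[\exists\vec x.\varphi]$ consists of a set $X$ of variables, a term $s$ and an existential constraint with $\mathcal{FV}ar(\exists\vec x.\varphi)\subseteq X\subseteq\mathcal{V}ar(s)$ and $\{\vec x\}\cap\mathcal{V}ar(s)=\emptyset$. Subsumption: $\Pi X.\,s\,[\exists\vec x.\varphi]\precsim\Pi Y.\,t\,[\exists\vec y.\psi]$ holds if for every $X$-valued substitution $\sigma$ with $\sigma\vDash_{\mathcal M}\exists\vec x.\varphi$ there is a $Y$-valued substitution $\gamma$ with $\gamma\vDash_{\mathcal M}\exists\vec y.\psi$ and $s\sigma=t\gamma$. Equivalence $\sim$ means subsumption in both directions. Value interpretation: $[\![\Pi X.\,s\,[\exists\vec x.\varphi]]\!]_{\mathsf v}$ is the set of all terms $s\sigma$ where $\sigma$ is a substitution such that $\sigma(X)\subseteq\mathcal{V}al$, $\sigma(\mathcal{V}ar(s)\setminus X)\subseteq\mathcal V$, $\sigma(x)\neq\sigma(y)$ for distinct $x,y\in\mathcal{V}ar(s)\setminus X$, and $\sigma\vDash_{\mathcal M}\exists\vec x.\varphi$. *)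

(* Defs.v *)
From mathcomp Require Import all_boot finmap.
From mathcomp Require Import boolp classical_sets.

Set Implicit Arguments.
Unset Strict Implicit.
Unset Printing Implicit Defensive.

Local Open Scope fset_scope.

Record signature := Signature {
  sort : eqType;
  theory_sort : pred sort;
  symbol : Type;
  theory_symbol : pred symbol;
  arg_sorts : symbol -> seq sort;
  res_sort : symbol -> sort;
  variable : choiceType;
  var_sort : variable -> sort;
  value : pred symbol;
  bool_sort : sort;
  theory_symbol_sorts : forall f, theory_symbol f ->
    all theory_sort (res_sort f :: arg_sorts f);
  value_theory : forall v, value v -> theory_symbol v;
  value_const : forall v, value v -> arg_sorts v = [::];
  bool_theory : theory_sort bool_sort
}.

(* The elements of the interpretation of a theory sort are themselves constant
   symbols, so the carrier of [tau] is the set of value symbols of sort [tau]. *)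
Definition carrier (Sg : signature) (tau : sort Sg) (v : symbol Sg) : Prop :=
  value v /\ res_sort v = tau.

Definition binary_connective (Sg : signature)
    (interp : symbol Sg -> seq (symbol Sg) -> symbol Sg)
    (bool_value : bool -> symbol Sg) (c : symbol Sg)
    (op : bool -> bool -> bool) : Prop :=
  [/\ theory_symbol c, arg_sorts c = [:: bool_sort Sg; bool_sort Sg],
      res_sort c = bool_sort Sg
    & forall a b, interp c [:: bool_value a; bool_value b]
                  = bool_value (op a b)].

(* [interp f] is meaningful only for a theory symbol [f] and argument lists in
   the carriers prescribed by [arg_sorts f]; elsewhere it is unconstrained. *)
Record model (Sg : signature) := Model {
  interp : symbol Sg -> seq (symbol Sg) -> symbol Sg;
  interp_carrier : forall f vs, theory_symbol f ->
    all (@value Sg) vs -> map (@res_sort Sg) vs = arg_sorts f ->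
    carrier (res_sort f) (interp f vs);
  interp_value : forall v, value v -> interp v [::] = v;
  bool_value : bool -> symbol Sg;
  bool_value_inj : injective bool_value;
  bool_carrier : forall v,
    carrier (bool_sort Sg) v <-> exists b, v = bool_value b;
  neg_symbol : symbol Sg;
  and_symbol : symbol Sg;
  or_symbol : symbol Sg;
  imp_symbol : symbol Sg;
  iff_symbol : symbol Sg;
  neg_connective : [/\ theory_symbol neg_symbol,
    arg_sorts neg_symbol = [:: bool_sort Sg],
    res_sort neg_symbol = bool_sort Sg
    & forall b, interp neg_symbol [:: bool_value b] = bool_value (~~ b)];
  and_connective : binary_connective interp bool_value and_symbol andb;
  or_connective : binary_connective interp bool_value or_symbol orb;
  imp_connective : binary_connective interp bool_value imp_symbol implb;
  iff_connective :
    binary_connective interp bool_value iff_symbol (fun a b => a == b)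
}.

Section Terms.
Variable Sg : signature.
Local Notation V := (variable Sg).

(* Raw terms; the sorted terms are those satisfying [well_sorted]. *)
Inductive term := Var of V | App of symbol Sg & seq term.

Definition sort_of (t : term) : sort Sg :=
  match t with Var x => var_sort x | App f _ => res_sort f end.

Fixpoint well_sorted (t : term) : bool :=
  match t with
  | Var _ => true
  | App f ts => all well_sorted ts && (map sort_of ts == arg_sorts f)
  end.

Fixpoint var_seq (t : term) : seq V :=
  match t with
  | Var x => [:: x]
  | App _ ts => flatten (map var_seq ts)
  end.

Definition vars (t : term) : {fset V} := [fset x in var_seq t].

Fixpoint theory_term (t : term) : bool :=
  match t with
  | Var _ => true
  | App f ts => theory_symbol f && all theory_term ts
  end.

Definition constraint (phi : term) : Prop :=
  [/\ well_sorted phi, sort_of phi = bool_sort Sg & theory_term phi].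

Fixpoint apply (sigma : V -> term) (t : term) : term :=
  match t with
  | Var x => sigma x
  | App f ts => App f (map (apply sigma) ts)
  end.

Record subst := Subst {
  subst_fun :> V -> term;
  subst_sorted : forall x,
    well_sorted (subst_fun x) /\ sort_of (subst_fun x) = var_sort x;
  subst_finite : exists D : {fset V},
    forall x, x \notin D -> subst_fun x = Var x
}.

Definition is_val (t : term) : Prop := exists2 v, value v & t = App v [::].

Definition is_var (t : term) : Prop := exists x, t = Var x.

Definition valued (X : {fset V}) (sigma : V -> term) : Prop :=
  forall x, x \in X -> is_val (sigma x).

Record econstraint := EConstraint {
  ebound : seq V;
  ebody : term;
  ebody_constraint : constraint ebody;
  ebound_sub : {subset ebound <= vars ebody}
}.

Definition fvars (xs : seq V) (phi : term) : {fset V} :=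
  vars phi `\` [fset x in xs].

Definition efvars (e : econstraint) : {fset V} := fvars (ebound e) (ebody e).

(* Body of [(exists xs. phi) sigma].  No renaming of [xs] is performed: this is
   only used when [sigma] maps the free variables to values, so that no capture
   can occur. *)
Definition esubst (sigma : V -> term) (xs : seq V) (phi : term) : term :=
  apply (fun x => if x \in xs then Var x else sigma x) phi.

Record ecterm := ECTerm {
  ec_set : {fset V};
  ec_term : term;
  ec_constraint : econstraint;
  ec_term_sorted : well_sorted ec_term;
  ec_fvars_sub : efvars ec_constraint `<=` ec_set;
  ec_set_sub : ec_set `<=` vars ec_term;
  ec_bound_disjoint : forall x, x \in ebound ec_constraint -> x \notin vars ec_term
}.

Variable M : model Sg.

Fixpoint eval (rho : V -> symbol Sg) (t : term) : symbol Sg :=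
  match t with
  | Var x => rho x
  | App f ts => interp M f (map (eval rho) ts)
  end.

(* Valuations are constrained only on the variables that matter, so that empty
   carriers of unrelated sorts are harmless. *)
Definition valuation_on (D : {fset V}) (rho : V -> symbol Sg) : Prop :=
  forall x, x \in D -> carrier (var_sort x) (rho x).

Definition eholds (rho : V -> symbol Sg) (xs : seq V) (phi : term) : Prop :=
  exists rho' : V -> symbol Sg,
    [/\ forall x, x \notin xs -> rho' x = rho x,
        valuation_on [fset x in xs] rho'
      & eval rho' phi = bool_value M true].

Definition valid (xs : seq V) (phi : term) : Prop :=
  forall rho, valuation_on (fvars xs phi) rho -> eholds rho xs phi.

Definition models (sigma : subst) (e : econstraint) : Prop :=
  valued (efvars e) sigma /\ valid (ebound e) (esubst sigma (ebound e) (ebody e)).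

Definition subsumed (C D : ecterm) : Prop :=
  forall sigma : subst,
    valued (ec_set C) sigma -> models sigma (ec_constraint C) ->
    exists gamma : subst,
      [/\ valued (ec_set D) gamma, models gamma (ec_constraint D)
        & apply sigma (ec_term C) = apply gamma (ec_term D)].

Definition equivalent (C D : ecterm) : Prop := subsumed C D /\ subsumed D C.

Definition value_interpretation (C : ecterm) : set term :=
  let Z := vars (ec_term C) `\` ec_set C in
  [set u | exists sigma : subst,
    [/\ valued (ec_set C) sigma,
        forall x, x \in Z -> is_var (sigma x),
        forall x y, x \in Z -> y \in Z -> x <> y -> sigma x <> sigma y,
        models sigma (ec_constraint C)
      & u = apply sigma (ec_term C)]]%classic.

End Terms.

(* Main.v *)
(** Replace [sigma] by the substitution that agrees with it on the logical
    variables [X] and is the identity elsewhere. It is still a model, its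
    instance of [s] lies in the value interpretation, and applying [sigma] to
    that instance gives back [s sigma], because values are closed. So equal
    value interpretations yield subsumption, by composing with [sigma].
    Conversely, if [s sigma = t gamma] with [sigma] injective into the variables
    outside [X], then [t] instantiated with the restriction of [gamma] equals
    some [s delta], and [delta] followed by [gamma] is [sigma] on the variables
    of [s]. Hence each non-logical variable [y] of [t] is [delta x] for a
    non-logical [x], and [gamma y = sigma x]: [gamma] is injective into the
    variables too. No fresh variables are needed. *)

Require Import Defs.
From mathcomp Require Import all_boot finmap.
From mathcomp Require Import boolp classical_sets.

Set Implicit Arguments.
Unset Strict Implicit.
Unset Printing Implicit Defensive.

Local Open Scope fset_scope.

Section Substitutions.
Variable Sg : signature.
Local Notation V := (variable Sg).
Local Notation term := (term Sg).
Implicit Types (t : term) (ts : seq term) (f g : V -> term) (X : {fset V}).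

(** Arguments of a symbol sit inside a list, so the generated principle says nothing about them; the
    [foldr] conjunction unfolds along an induction on that list. *)
Lemma term_nested_ind (P : term -> Prop) :
  (forall x, P (Var x)) ->
  (forall s ts, foldr (fun t => and (P t)) True ts -> P (App s ts)) ->
  forall t, P t.
Proof.
move=> PV PA; fix IH 1 => -[x|s ts]; first exact: PV.
by apply: PA; elim: ts => [//|t ts IHts]; split; [exact: IH|exact: IHts].
Qed.

Lemma in_vars t x : (x \in vars t) = (x \in var_seq t).
Proof. by rewrite /vars !inE. Qed.

Lemma apply_comp f g t : apply g (apply f t) = apply (apply g \o f) t.
Proof.
elim/term_nested_ind: t => //= s ts IHs; congr App.
by elim: ts IHs => //= t ts IH [-> /IH ->].
Qed.

(** The converse holds because constructors are injective: an instance of [t] determines the image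
    of every variable of [t]. *)
Lemma eq_in_apply f g t :
  {in vars t, f =1 g} <-> apply f t = apply g t.
Proof.
suff: {in var_seq t, f =1 g} <-> apply f t = apply g t.
  by move=> <-; split=> fg x; have := fg x; rewrite in_vars.
elim/term_nested_ind: t => [x|s ts IHs] /=.
  by split=> [-> //|fg y]; rewrite ?inE // => /eqP ->.
suff fg_ts : {in flatten (map (@var_seq Sg) ts), f =1 g} <->
             map (apply f) ts = map (apply g) ts.
  by split=> [/fg_ts->|[/fg_ts]].
elim: ts IHs => //= t ts IH [IHt /IH IHts]; split=> [fg|[/IHt ft /IHts fts] x].
  congr cons; first by apply/IHt => x xt; apply: fg; rewrite mem_cat xt.
  by apply/IHts => x xt; apply: fg; rewrite mem_cat xt orbT.
by rewrite mem_cat => /orP[/ft|/fts].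
Qed.

Lemma var_seq_apply f t :
  var_seq (apply f t) = flatten (map (@var_seq Sg \o f) (var_seq t)).
Proof.
elim/term_nested_ind: t => [x|s ts] /=; first by rewrite cats0.
by elim: ts => //= t ts IH [-> /IH ->]; rewrite map_cat flatten_cat.
Qed.

Lemma vars_applyP f t x :
  reflect (exists2 y, y \in vars t & x \in vars (f y)) (x \in vars (apply f t)).
Proof.
rewrite in_vars var_seq_apply; apply: (equivP flatten_mapP).
by split=> -[y yt xy]; exists y; rewrite ?in_vars // -in_vars.
Qed.

Lemma apply_is_val f t : is_val t -> apply f t = t.
Proof. by case=> v _ ->. Qed.

Lemma is_val_vars t x : is_val t -> x \notin vars t.
Proof. by case=> v _ ->; rewrite in_vars. Qed.

Lemma sort_of_apply (sigma : subst Sg) t : sort_of (apply sigma t) = sort_of t.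
Proof. by case: t => //= x; case: (subst_sorted sigma x). Qed.

Lemma well_sorted_apply (sigma : subst Sg) t :
  well_sorted t -> well_sorted (apply sigma t).
Proof.
elim/term_nested_ind: t => [x _|s ts IHs] /=.
  by case: (subst_sorted sigma x).
case/andP=> ws ar; apply/andP; split.
  by elim: ts IHs ws {ar} => //= t ts IH [IHt /IH IHts] /andP[/IHt-> /IHts->].
by rewrite -map_comp (eq_map (sort_of_apply sigma)).
Qed.

Lemma comp_subst_sorted (sigma tau : subst Sg) x :
  well_sorted (apply tau (sigma x)) /\ sort_of (apply tau (sigma x)) = var_sort x.
Proof.
have [ws so] := subst_sorted sigma x.
by rewrite sort_of_apply well_sorted_apply.
Qed.

Lemma comp_subst_finite (sigma tau : subst Sg) :
  exists D : {fset V}, forall x, x \notin D -> apply tau (sigma x) = Var x.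
Proof.
have [A idA] := subst_finite sigma; have [B idB] := subst_finite tau.
exists (A `|` B) => x; rewrite inE negb_or => /andP[xA xB].
by rewrite idA //= idB.
Qed.

Definition comp_subst (sigma tau : subst Sg) : subst Sg :=
  Subst (comp_subst_sorted sigma tau) (comp_subst_finite sigma tau).

Definition restrict X f x : term := if x \in X then f x else Var x.

Lemma restrict_subst_sorted X (sigma : subst Sg) x :
  well_sorted (restrict X sigma x) /\ sort_of (restrict X sigma x) = var_sort x.
Proof. by rewrite /restrict; case: ifP => // _; exact: subst_sorted. Qed.

Lemma restrict_subst_finite X (sigma : subst Sg) :
  exists D : {fset V}, forall x, x \notin D -> restrict X sigma x = Var x.
Proof. by exists X => x; rewrite /restrict; case: ifP. Qed.

Definition restrict_subst X (sigma : subst Sg) : subst Sg :=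
  Subst (restrict_subst_sorted X sigma) (restrict_subst_finite X sigma).

Lemma restrict_in X f : {in X, restrict X f =1 f}.
Proof. by move=> x; rewrite /restrict => ->. Qed.

(** On [X] the first pass produces closed values, which the second leaves alone; elsewhere the first
    pass does nothing. *)
Lemma apply_restrict X f t :
  valued X f -> apply f (apply (restrict X f) t) = apply f t.
Proof.
move=> Xf; rewrite apply_comp; apply/eq_in_apply => x _ /=; rewrite /restrict.
by case: ifP => // /Xf /apply_is_val.
Qed.

Lemma eq_in_valued X f g : {in X, f =1 g} -> valued X f -> valued X g.
Proof. by move=> fg Xf x xX; rewrite -fg //; exact: Xf. Qed.

Variable M : model Sg.

(** [esubst] fixes the bound variables, so the instantiated body depends only on the images of the
    free ones. *)
Lemma eq_in_models (e : econstraint Sg) (sigma tau : subst Sg) :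
  {in efvars e, sigma =1 tau} -> models M sigma e -> models M tau e.
Proof.
move=> st [vs Ms]; split; first exact: eq_in_valued vs.
suff <- : esubst sigma (ebound e) (ebody e) = esubst tau (ebound e) (ebody e).
  by [].
apply/eq_in_apply => x xe /=; case: ifPn => // xb; apply: st.
by rewrite /efvars /fvars in_fsetD xe !inE xb.
Qed.

Lemma eq_in_models_ecterm (C : ecterm Sg) (sigma tau : subst Sg) :
  {in ec_set C, sigma =1 tau} ->
  models M sigma (ec_constraint C) -> models M tau (ec_constraint C).
Proof.
move=> st; apply: eq_in_models => x xC; apply: st.
exact: (fsubsetP (ec_fvars_sub C)).
Qed.

Lemma restrict_models (C : ecterm Sg) (sigma : subst Sg) :
  models M sigma (ec_constraint C) ->
  models M (restrict_subst (ec_set C) sigma) (ec_constraint C).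
Proof. by apply: eq_in_models_ecterm => x xC; rewrite /= restrict_in. Qed.

Lemma restrict_valued X (sigma : subst Sg) :
  valued X sigma -> valued X (restrict_subst X sigma).
Proof. by apply: eq_in_valued => x xX; rewrite /= restrict_in. Qed.

Lemma value_interpretation_sub_subsumed (C D : ecterm Sg) :
  (value_interpretation M C `<=` value_interpretation M D)%classic ->
  subsumed M C D.
Proof.
move=> CD sigma Xs Ms.
have /CD[gamma [Yg _ _ Mg eg]] : value_interpretation M C
    (apply (restrict_subst (ec_set C) sigma) (ec_term C)).
  exists (restrict_subst (ec_set C) sigma); split=> //=.
  - exact: restrict_valued.
  - by move=> x; rewrite in_fsetD /restrict => /andP[/negPf-> _]; exists x.
  - move=> x y; rewrite !in_fsetD /restrict.
    by move=> /andP[/negPf-> _] /andP[/negPf-> _] xy [].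
  - exact: restrict_models.
(* Values are closed, so following [gamma] by [sigma] changes nothing on the logical variables. *)
have gg : {in ec_set D, gamma =1 comp_subst gamma sigma}.
  by move=> x xD /=; rewrite apply_is_val //; exact: Yg.
exists (comp_subst gamma sigma); split.
- exact: eq_in_valued Yg.
- exact: eq_in_models_ecterm Mg.
- by rewrite -[LHS](apply_restrict _ Xs) [apply (restrict _ _) _]eg apply_comp.
Qed.

Lemma equivalent_value_interpretation_sub (C D : ecterm Sg) :
  equivalent M C D ->
  (value_interpretation M C `<=` value_interpretation M D)%classic.
Proof.
move=> [CD DC] _ [sigma [Xs vs inj_s Ms ->]].
have [gamma [Yg Mg eg]] := CD _ Xs Ms.
have [delta [Xd _ ed]] := DC _ (restrict_valued Yg) (restrict_models Mg).
(* With s and t the terms of [C] and [D], applying [gamma] to s [delta] gives t [gamma], which is s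
   [sigma]. *)
have ds : {in vars (ec_term C), apply gamma \o delta =1 sigma}.
  by apply/eq_in_apply; rewrite -apply_comp -ed /= apply_restrict.
have key y : y \in vars (ec_term D) `\` ec_set D ->
    exists x, [/\ x \in vars (ec_term C) `\` ec_set C, delta x = Var y
                & gamma y = sigma x].
  rewrite in_fsetD => /andP[yY yt].
  have : y \in vars (apply delta (ec_term C)).
    rewrite -ed; apply/vars_applyP; exists y => //=.
    by rewrite /restrict (negPf yY) in_vars inE.
  case/vars_applyP=> x xs yx.
  (* Otherwise [delta x] would be a value and could not contain [y]. *)
  have xZ : x \in vars (ec_term C) `\` ec_set C.
    rewrite in_fsetD xs andbT; apply/negP => /Xd /is_val_vars.
    by move=> /(_ y); rewrite yx.
  exists x; have := ds _ xs; have [z ez] := vs _ xZ; rewrite /= ez.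
  (* Since [gamma] sends [delta x] to a variable, [delta x] is itself a variable, and it can only be
     [y]. *)
  case: (delta x) yx => //= z'; rewrite in_vars mem_seq1 => /eqP <-.
  by split.
exists gamma; split=> //.
- by move=> y /key[x [/vs[z sz] _ ->]]; exists z.
(* Distinct [y], [y'] come from distinct [x], [x'], as [delta] maps [x] to [y] and [x'] to [y'];
   injectivity of [sigma] then applies. *)
- move=> y y' /key[x [xZ dx ->]] /key[x' [xZ' dx' ->]] yy'.
  by apply: inj_s => // xx'; apply: yy'; move: dx; rewrite xx' dx' => -[].
Qed.

End Substitutions.

Theorem theorem5p6 (Sg : signature) (M : model Sg) (C D : ecterm Sg) :
  equivalent M C D <-> value_interpretation M C = value_interpretation M D.
Proof.
split=> [CD|eCD].
  apply/seteqP; split; apply: equivalent_value_interpretation_sub => //.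
  by case: CD.
by split; apply: value_interpretation_sub_subsumed; rewrite eCD.
Qed.
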